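(* Let $A$ be an integrally closed noetherian domain with fraction field $K$, and let $M$ be a differential module of rank $\mu$ over $A((x))$, where $\mu$ is strictly smaller than every nonzero residue characteristic of $A$. Then for every point $P$ of $Z=\mathrm{Spec}\,A$, $$NP(M_{(P)})\subset NP(M).$$
   Context: $A((x))=A[[x]][1/x]$, $\partial=x\frac{d}{dx}$. A differential module over $A((x))$ is a finitely generated projective $A((x))$-module $M$ with a continuous $A$-linear operator $\nabla(\partial)$ satisfying the Leibniz rule. For $P\in\mathrm{Spec}\,A$ with residue field $\kappa_P$, $M_{(P)}=M\otimes_{A((x))}\kappa_P((x))$ is the specialized differential module over $\kappa_P((x))$. $NP(M)$ denotes the Newton polygon of $M_{K((x))}=M\otimes_{A((x))}K((x))$. Newton polygon. Let $K$ be a field, $F=K((x))$ with $v=\mathrm{ord}_x$, and $N$ a differential module of dimension $\mu$ over $F$ (with $\mu<\mathrm{char}\,K$ if $\mathrm{char}\,K\ne0$). $N$ is regular if it has a basis in which $\nabla(\partial)$ has matrix with entries in $K[[x]]$. By the Turrittin–Levelt theorem, over some finite Galois extension $F'=K'((x^{1/e}))$ of $F$ of degree dividing $\mu!$ there is a unique decomposition $N_{F'}=\bigoplus_jN_{\phi_j}$, $N_{\phi_j}\cong L_{\phi_j}\otimes R_j$, with $\phi_j\in x^{-1/e}K'[x^{-1/e}]$ pairwise distinct, $L_\phi=(F',\nabla(\partial)(1)=\phi)$ and $R_j$ regular. $NP(N)$ is the convex polygon in $[0,\mu]\times\mathbb R$, unbounded above, whose rightmost vertex is $(\mu,0)$ and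 whose side of slope $\sigma\ge0$ has horizontal length $\sum_{j:\ \max(0,-v(\phi_j))=\sigma}\dim R_j$ for every $\sigma$. *)

(* Defs.v *)
From HB Require Import structures.
From mathcomp Require Import all_boot all_order all_fingroup all_algebra all_field.
From mathcomp Require Import boolp classical_sets functions cardinality fsbigop.
From mathcomp Require Import reals.
From mathcomp Require Import zify.

Set Implicit Arguments.
Unset Strict Implicit.
Unset Printing Implicit Defensive.

Import Order.TTheory GRing.Theory Num.Theory.
Local Open Scope classical_set_scope.
Local Open Scope ring_scope.

(* A((x)) is encoded as the functions int -> A (the coefficients) vanishing on all
   sufficiently negative integers. *)
Definition low_bound (A : zmodType) (f : int -> A) (a : nat) : Prop :=
  forall n : int, n < - a%:Z -> f n = 0.

Record laurent (A : zmodType) := Laurent {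
  lcoef :> int -> A;
  lcoefP : exists a : nat, low_bound lcoef a }.

Notation "{ 'laurent' A }" := (laurent A) (format "{ 'laurent'  A }") : type_scope.

HB.instance Definition _ (A : zmodType) := gen_eqMixin {laurent A}.
HB.instance Definition _ (A : zmodType) := gen_choiceMixin {laurent A}.

Lemma laurentP (A : zmodType) (f g : {laurent A}) : (forall n, f n = g n) -> f = g.
Proof.
case: f g => [f fP] [g gP] /= /funext fg; rewrite -{}fg in gP *.
by congr Laurent; exact: Prop_irrelevance.
Qed.

Lemma low_bound_le (A : zmodType) (f : int -> A) a b :
  (a <= b)%N -> low_bound f a -> low_bound f b.
Proof. by move=> ab fa n nb; apply: fa; lia. Qed.

Section LaurentZmod.
Variable A : zmodType.
Implicit Types f g h : {laurent A}.

Fact lzero_subproof : exists a, low_bound (fun=> 0 : A) a.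
Proof. by exists 0%N. Qed.
Definition lzero : {laurent A} := Laurent lzero_subproof.

Fact lopp_subproof f : exists a, low_bound (fun n => - f n) a.
Proof. by have [a fa] := lcoefP f; exists a => n /fa->; rewrite oppr0. Qed.
Definition lopp f : {laurent A} := Laurent (lopp_subproof f).

Fact ladd_subproof f g : exists a, low_bound (fun n => f n + g n) a.
Proof.
have [a fa] := lcoefP f; have [b gb] := lcoefP g; exists (maxn a b) => n nab.
by rewrite fa ?gb ?addr0 //; lia.
Qed.
Definition ladd f g : {laurent A} := Laurent (ladd_subproof f g).

Fact laddA : associative ladd.
Proof. by move=> f g h; apply: laurentP => n /=; rewrite addrA. Qed.
Fact laddC : commutative ladd.
Proof. by move=> f g; apply: laurentP => n /=; rewrite addrC. Qed.
Fact ladd0 : left_id lzero ladd.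
Proof. by move=> f; apply: laurentP => n /=; rewrite add0r. Qed.
Fact laddN : left_inverse lzero lopp ladd.
Proof. by move=> f; apply: laurentP => n /=; rewrite addNr. Qed.

HB.instance Definition _ :=
  GRing.isZmodule.Build {laurent A} laddA laddC ladd0 laddN.
End LaurentZmod.

Section LaurentRing.
Variable A : comNzRingType.
Implicit Types (f g h : {laurent A}) (F G : int -> A).

(* All but finitely many terms of this sum vanish. *)
Definition conv F G (n : int) : A := \sum_(i \in [set: int]) F i * G (n - i).

(* The polynomial with coefficients F (-a), ..., F (N - 1 - a). *)
Definition window (a N : nat) F : {poly A} := \poly_(k < N) F (k%:Z - a%:Z).

Lemma convE F G a b (m N : nat) : low_bound F a -> low_bound G b -> (m < N)%N ->
  conv F G (m%:Z - a%:Z - b%:Z) = (window a N F * window b N G)`_m.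
Proof.
move=> Fa Gb mN; rewrite /conv.
rewrite (fsbigE [seq k%:Z - a%:Z | k <- iota 0 m.+1]).
- rewrite (eq_bigl xpredT); last by move=> i; rewrite in_setT.
  rewrite big_map -[iota 0 m.+1]/(index_iota 0 m.+1) big_mkord coefM.
  apply: eq_bigr => i _; have := ltn_ord i => im.
  have iN : (i < N)%N by apply: leq_trans mN.
  have miN : (m - i < N)%N by apply: leq_ltn_trans mN; exact: leq_subr.
  rewrite !coef_poly iN miN; congr (_ * G _).
  by rewrite -subzn //; lia.
- by rewrite map_inj_uniq ?iota_uniq // => x y; lia.
- by [].
- move=> i _ /mapP iN.
  have [ia|ai] := ltP i (- a%:Z); first by rewrite Fa ?mul0r.
  rewrite Gb ?mulr0 //; rewrite ltNge; apply/negP => h; apply: iN.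
  exists (absz (i + a%:Z)); first by rewrite mem_iota; lia.
  by lia.
Qed.

Lemma conv_low F G a b :
  low_bound F a -> low_bound G b -> low_bound (conv F G) (a + b).
Proof.
move=> Fa Gb n nab; rewrite /conv fsbig1 // => i _.
have [ia|ai] := ltP i (- a%:Z); first by rewrite Fa ?mul0r.
by rewrite Gb ?mulr0 //; lia.
Qed.

Lemma window_conv F G a b N : low_bound F a -> low_bound G b ->
  forall m, (m < N)%N ->
  (window (a + b) N (conv F G))`_m = (window a N F * window b N G)`_m.
Proof.
move=> Fa Gb m mN; rewrite coef_poly mN -(convE Fa Gb mN).
by congr (conv _ _ _); lia.
Qed.

Fact lmul_subproof f g : exists a, low_bound (conv f g) a.
Proof.
have [a fa] := lcoefP f; have [b gb] := lcoefP g.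
by exists (a + b)%N; exact: conv_low.
Qed.
Definition lmul f g : {laurent A} := Laurent (lmul_subproof f g).

Fact lconst_subproof (c : A) :
  exists a, low_bound (fun n : int => if n == 0 then c else 0) a.
Proof. by exists 0%N => n n0; case: eqP => // n00; lia. Qed.
Definition lconst (c : A) : {laurent A} := Laurent (lconst_subproof c).

Lemma coefM_eq (p q p' q' : {poly A}) N m : (m < N)%N ->
  (forall k, (k < N)%N -> p`_k = p'`_k) -> (forall k, (k < N)%N -> q`_k = q'`_k) ->
  (p * q)`_m = (p' * q')`_m.
Proof.
move=> mN pp qq; rewrite !coefM; apply: eq_bigr => i _.
by have := ltn_ord i => im; rewrite pp ?qq //; lia.
Qed.

Fact lmulA : associative lmul.
Proof.
move=> f g h; apply: laurentP => n /=.
have [a fa] := lcoefP f; have [b gb] := lcoefP g; have [c hc] := lcoefP h.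
have fgab := conv_low fa gb; have ghbc := conv_low gb hc.
have [nlo|nhi] := ltP n (- (a + b + c)%:Z).
  by rewrite (conv_low fgab hc) // (conv_low fa ghbc) //; lia.
pose m := absz (n + (a + b + c)%:Z).
rewrite [in LHS](_ : n = m%:Z - a%:Z - (b + c)%:Z); last by lia.
rewrite [in RHS](_ : n = m%:Z - (a + b)%:Z - c%:Z); last by lia.
rewrite (convE fa ghbc (ltnSn m)) (convE fgab hc (ltnSn m)).
rewrite (@coefM_eq _ _ (window a m.+1 f) (window b m.+1 g * window c m.+1 h) m.+1) //.
  rewrite mulrA; symmetry.
  by apply: (@coefM_eq _ _ _ _ m.+1) => // k km; exact: window_conv.
by move=> k km; exact: window_conv.
Qed.

Fact lmulC : commutative lmul.
Proof.
move=> f g; apply: laurentP => n /=.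
have [a fa] := lcoefP f; have [b gb] := lcoefP g.
have [nlo|nhi] := ltP n (- (a + b)%:Z).
  by rewrite (conv_low fa gb) // (conv_low gb fa) //; lia.
pose m := absz (n + (a + b)%:Z).
rewrite [in LHS](_ : n = m%:Z - a%:Z - b%:Z); last by lia.
rewrite [in RHS](_ : n = m%:Z - b%:Z - a%:Z); last by lia.
by rewrite (convE fa gb (ltnSn m)) (convE gb fa (ltnSn m)) mulrC.
Qed.

Fact lconst_low c : low_bound (lconst c) 0.
Proof. by move=> n n0 /=; case: eqP => // n00; lia. Qed.

Lemma lconstM c f n : lmul (lconst c) f n = c * f n.
Proof.
rewrite /= /conv (fsbigE [:: 0 : int]) //.
  by rewrite big_cons big_nil in_setT /= subr0 addr0.
by move=> i _; rewrite inE => /negPf ->; rewrite mul0r.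
Qed.

Fact lmul1 : left_id (lconst 1) lmul.
Proof. by move=> f; apply: laurentP => n; rewrite lconstM mul1r. Qed.

Fact lmulDl : left_distributive lmul +%R.
Proof.
move=> f g h; apply: laurentP => n.
have [a0 fa0] := lcoefP f; have [b0 gb0] := lcoefP g; have [c hc] := lcoefP h.
pose a := maxn a0 b0.
have fa : low_bound f a by apply: low_bound_le fa0; lia.
have ga : low_bound g a by apply: low_bound_le gb0; lia.
have fga : low_bound (f + g) a by move=> k ka; rewrite /= fa ?ga ?addr0.
have [nlo|nhi] := ltP n (- (a + c)%:Z).
  by rewrite /= !(conv_low _ hc nlo) ?addr0.
pose m := absz (n + (a + c)%:Z).
rewrite (_ : n = m%:Z - a%:Z - c%:Z); last by lia.
rewrite /= !(@convE _ _ _ _ _ m.+1 _ hc) // -coefD -mulrDl.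
congr (nth 0 (polyseq (_ * _)) m).
by apply/polyP => k; rewrite coefD !coef_poly; case: ifP; rewrite ?addr0.
Qed.

Fact lone_neq0 : lconst 1 != 0.
Proof.
by apply/eqP => /(congr1 (fun f : {laurent A} => f 0)) /eqP; rewrite /= oner_eq0.
Qed.

HB.instance Definition _ := GRing.Zmodule_isComNzRing.Build {laurent A}
  lmulA lmulC lmul1 lmulDl lone_neq0.

(* The derivation c x d/dx; it is x d/dx itself for c = 1. *)
Fact euler_subproof c f : exists a, low_bound (fun n => c * (f n *~ n)) a.
Proof. by have [a fa] := lcoefP f; exists a => n /fa->; rewrite mul0rz mulr0. Qed.
Definition euler c f : {laurent A} := Laurent (euler_subproof c f).

End LaurentRing.

(* Coefficientwise extension A((x)) -> B((x)) of a ring morphism A -> B. *)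
Section LaurentMap.
Variables (A B : comNzRingType) (u : {rmorphism A -> B}).

Fact lmap_subproof (f : {laurent A}) : exists a, low_bound (fun n => u (f n)) a.
Proof. by have [a fa] := lcoefP f; exists a => n /fa->; rewrite rmorph0. Qed.
Definition lmap (f : {laurent A}) : {laurent B} := Laurent (lmap_subproof f).

Fact lmap_is_zmod_morphism : zmod_morphism lmap.
Proof. by move=> f g; apply: laurentP => n; rewrite /= rmorphB. Qed.

Fact lmap_is_monoid_morphism : monoid_morphism lmap.
Proof.
split=> [|f g]; apply: laurentP => n /=.
  by case: ifP; rewrite ?rmorph1 ?rmorph0.
have [a fa] := lcoefP f; have [b gb] := lcoefP g.
have fa' : low_bound (lmap f) a by move=> k /fa /= ->; rewrite rmorph0.
have gb' : low_bound (lmap g) b by move=> k /gb /= ->; rewrite rmorph0.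
have [nlo|nhi] := ltP n (- (a + b)%:Z).
  by rewrite (conv_low fa gb) // (conv_low fa' gb') // rmorph0.
pose m := absz (n + (a + b)%:Z).
rewrite (_ : n = m%:Z - a%:Z - b%:Z); last by lia.
rewrite (convE fa gb (ltnSn m)) (convE fa' gb' (ltnSn m)) !coefM rmorph_sum.
apply: eq_bigr => i _; rewrite rmorphM !coef_poly.
by congr (_ * _); case: ifP; rewrite ?rmorph0.
Qed.

HB.instance Definition _ :=
  GRing.isZmodMorphism.Build {laurent A} {laurent B} lmap lmap_is_zmod_morphism.
HB.instance Definition _ :=
  GRing.isMonoidMorphism.Build {laurent A} {laurent B} lmap lmap_is_monoid_morphism.
End LaurentMap.

(* The inclusion A((x)) -> A((t)), x |-> t^(e+1); the ramification index is
   e.+1 so that this is a ring morphism for every e. *)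
Section Ramification.
Variables (A : comNzRingType) (e : nat).

Definition ramcoef (F : int -> A) (n : int) : A :=
  if (e.+1%:Z %| n)%Z then F (n %/ e.+1%:Z)%Z else 0.

Lemma ramcoef_low F a : low_bound F a -> low_bound (ramcoef F) (a * e.+1).
Proof.
move=> Fa n na; rewrite /ramcoef; case: dvdzP => // -[q nE].
by rewrite nE mulzK // Fa //; nia.
Qed.

Fact ram_subproof (f : {laurent A}) : exists a, low_bound (ramcoef f) a.
Proof. by have [a fa] := lcoefP f; exists (a * e.+1)%N; exact: ramcoef_low. Qed.
Definition ram (f : {laurent A}) : {laurent A} := Laurent (ram_subproof f).

Lemma window_ram F a N :
  window (a * e.+1) (N * e.+1) (ramcoef F) = window a N F \Po 'X^(e.+1).
Proof.
apply/polyP => k; rewrite coef_comp_poly_Xn // !coef_poly /ramcoef.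
have -> : (e.+1%:Z %| k%:Z - (a * e.+1)%:Z)%Z = (e.+1 %| k)%N.
  by rewrite PoszM rpredBr ?dvdz_mull // /dvdz.
case: (boolP (e.+1 %| k)%N) => [/dvdnP[q ->]|_]; last by rewrite if_same.
rewrite mulnK // ltn_mul2r /= !PoszM -mulrBl mulzK //.
Qed.

Fact ram_is_zmod_morphism : zmod_morphism ram.
Proof.
move=> f g; apply: laurentP => n; rewrite /= /ramcoef /=.
by case: ifP; rewrite ?subr0.
Qed.

Fact ram_is_monoid_morphism : monoid_morphism ram.
Proof.
split=> [|f g]; apply: laurentP => n /=.
  rewrite /ramcoef /=; case: dvdzP => [[q ->]|nd].
    by rewrite mulzK // mulf_eq0 orbF.
  by case: eqP => // n0; case: nd; exists 0; rewrite mul0r.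
have [a fa] := lcoefP f; have [b gb] := lcoefP g.
have fa' := ramcoef_low fa; have gb' := ramcoef_low gb.
have [nlo|nhi] := ltP n (- (a * e.+1 + b * e.+1)%N%:Z).
  rewrite [RHS](conv_low fa' gb') //.
  by apply: (ramcoef_low (conv_low fa gb)); lia.
pose m := absz (n + (a * e.+1 + b * e.+1)%N%:Z).
have nE : n = m%:Z - (a * e.+1)%N%:Z - (b * e.+1)%N%:Z by lia.
have mN : (m < m.+1 * e.+1)%N by nia.
rewrite [in RHS]nE (convE fa' gb' mN) !window_ram -rmorphM /=.
rewrite coef_comp_poly_Xn // /ramcoef nE.
have -> : (e.+1%:Z %| m%:Z - (a * e.+1)%N%:Z - (b * e.+1)%N%:Z)%Z = (e.+1 %| m)%N.
  by rewrite !PoszM !rpredBr ?dvdz_mull // /dvdz.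
case: dvdnP => [[q mE]|//].
rewrite mE mulnK // !PoszM -!mulrBl mulzK //.
by apply: convE => //; nia.
Qed.

HB.instance Definition _ :=
  GRing.isZmodMorphism.Build {laurent A} {laurent A} ram ram_is_zmod_morphism.
HB.instance Definition _ :=
  GRing.isMonoidMorphism.Build {laurent A} {laurent A} ram ram_is_monoid_morphism.
End Ramification.

Definition integral_series (A : zmodType) (f : {laurent A}) : Prop :=
  forall n : int, n < 0 -> f n = 0.

(* f lies in x^-1 A[x^-1]. *)
Definition polar (A : zmodType) (f : {laurent A}) : Prop :=
  forall n : int, 0 <= n -> f n = 0.

Fact pole_order_subproof (A : zmodType) (f : {laurent A}) :
  exists a : nat, `[< low_bound f a >].
Proof. by have [a fa] := lcoefP f; exists a; apply/asboolP. Qed.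

(* max (0, - v f), with v the order of f at x = 0 and v 0 = +oo. *)
Definition pole_order (A : zmodType) (f : {laurent A}) : nat :=
  ex_minn (pole_order_subproof f).

Section ClassicalUnits.
Variable R : comNzRingType.

Definition cunit : {pred R} := fun x => `[< exists y, y * x = 1 >].
Definition cinv (x : R) : R := xget x [set y | y * x = 1].

Fact cmulVr : {in cunit, left_inverse 1 cinv *%R}.
Proof. by move=> x /asboolP[y yx]; rewrite /cinv; case: xgetP => [z _ //|/(_ y)]. Qed.
Fact cunitPl x y : y * x = 1 -> cunit x.
Proof. by move=> yx; apply/asboolP; exists y. Qed.
Fact cinv_out : {in [predC cunit], cinv =1 id}.
Proof.
move=> x /negP xn; rewrite /cinv; case: xgetP => // y _ yx.
by case: xn; exact: cunitPl yx.
Qed.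
End ClassicalUnits.

Section ResidueField.
Variables (A : comNzRingType) (P : prime_idealr A).

Definition prime_quot : Type := {ideal_quot P}.
HB.instance Definition _ := GRing.ComNzRing.on prime_quot.
HB.instance Definition _ := GRing.ComNzRing_hasMulInverse.Build prime_quot
  (@cmulVr prime_quot) (@cunitPl prime_quot) (@cinv_out prime_quot).
HB.instance Definition _ := GRing.ComUnitRing_isIntegral.Build prime_quot
  (@Quotient.rquot_IdomainAxiom A P).

Definition residue_field : fieldType := {fraction prime_quot}.

Definition to_prime_quot : A -> prime_quot := (\pi_{ideal_quot P})%qT.
HB.instance Definition _ := GRing.RMorphism.on to_prime_quot.

Definition to_residue : {rmorphism A -> residue_field} :=
  @FracField.tofrac prime_quot \o to_prime_quot.
End ResidueField.

Definition is_ideal (A : comNzRingType) (I : set A) : Prop :=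
  [/\ I 0, forall x y, I x -> I y -> I (x + y) & forall a x, I x -> I (a * x)].

Definition noetherian (A : comNzRingType) : Prop :=
  forall I : set A, is_ideal I -> exists (n : nat) (g : 'I_n -> A),
    I = [set x | exists c : 'I_n -> A, x = \sum_i c i * g i].

Definition integrally_closed (A : idomainType) : Prop :=
  forall z : {fraction A}, integralOver (@FracField.tofrac A) z ->
    exists a : A, z = FracField.tofrac a.

Definition spans (R : comNzRingType) (M : lmodType R) n (g : 'I_n -> M) : Prop :=
  forall v, exists c : 'rV[R]_n, v = \sum_i c 0 i *: g i.

Definition is_basis (R : comNzRingType) (M : lmodType R) n (b : 'I_n -> M) : Prop :=
  forall v, exists! c : 'rV[R]_n, v = \sum_i c 0 i *: b i.

Definition has_dim (R : comNzRingType) (M : lmodType R) (n : nat) : Prop :=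
  exists b : 'I_n -> M, is_basis b.

(* M is a direct summand of a finite free module. *)
Definition fg_projective (R : comNzRingType) (M : lmodType R) : Prop :=
  exists (n : nat) (p : {linear 'rV[R]_n -> M}) (s : {linear M -> 'rV[R]_n}),
    cancel s p.

Section BaseChange.
Variables (R S : comNzRingType) (u : {rmorphism R -> S}) (M : lmodType R).

Definition semilinear_along (N : lmodType S) (f : M -> N) : Prop :=
  (forall x y, f (x + y) = f x + f y) /\ (forall a x, f (a *: x) = u a *: f x).

(* (N, i) is the extension of scalars of M along u, that is N = M (x)_R S with
   i m = m (x) 1, characterized by its universal property. *)
Definition is_base_change (N : lmodType S) (i : M -> N) : Prop :=
  semilinear_along i /\
  forall (L : lmodType S) (f : M -> L), semilinear_along f ->
    exists g : {linear N -> L}, g \o i =1 f /\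
      forall g' : {linear N -> L}, g' \o i =1 f -> g' =1 g.
End BaseChange.

(* Every fibre of M over Spec R has dimension mu. *)
Definition has_rank (R : comNzRingType) (M : lmodType R) (mu : nat) : Prop :=
  forall Q : prime_idealr R, exists (N : lmodType (residue_field Q)) (i : M -> N),
    is_base_change (to_residue Q) i /\ has_dim N mu.

Section DifferentialModule.
Variables (A : comNzRingType) (c : A).

(* The subset x^k (A[[x]] g_1 + ... + A[[x]] g_n). *)
Definition xadic_nbhd (M : lmodType {laurent A}) n (g : 'I_n -> M) (k : nat)
    : set M :=
  [set v | exists f : 'I_n -> {laurent A},
     (forall i (m : int), m < k%:Z -> f i m = 0) /\ v = \sum_i f i *: g i].

(* For a finite generating family g of M, the sets xadic_nbhd g k are a basis
   of neighbourhoods of 0 for the x-adic topology; additive maps are continuous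
   as soon as they are at 0. *)
Definition xadic_continuous (M : lmodType {laurent A}) (D : M -> M) : Prop :=
  forall n (g : 'I_n -> M), spans g ->
  forall k, exists l, D @` xadic_nbhd g l `<=` xadic_nbhd g k.

Record is_connection (M : lmodType {laurent A}) (D : M -> M) : Prop := {
  connD : forall u v, D (u + v) = D u + D v;
  connZ : forall (a : A) v, D (lconst a *: v) = lconst a *: D v;
  conn_leibniz : forall (f : {laurent A}) v,
    D (f *: v) = euler c f *: v + f *: D v;
  conn_continuous : xadic_continuous D }.

Record diffmod := DiffMod {
  diffmod_mod :> lmodType {laurent A};
  nabla : diffmod_mod -> diffmod_mod;
  diffmod_projective : fg_projective diffmod_mod;
  nabla_connection : is_connection nabla }.

(* The matrix of nabla in some basis has entries in A[[x]]. *)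
Definition regular (N : diffmod) (d : nat) : Prop :=
  exists (b : 'I_d -> N) (G : 'M[{laurent A}]_d),
    [/\ is_basis b, forall k, nabla (b k) = \sum_l G l k *: b l
      & forall l k, integral_series (G l k)].

(* The operator of L_phi (x) N, where L_phi = A((x)) with nabla 1 = phi; the
   underlying module of L_phi (x) N is identified with that of N. *)
Definition twist (phi : {laurent A}) (N : diffmod) (v : N) : N :=
  phi *: v + nabla v.

End DifferentialModule.

Definition is_diff_base_change (A B : comNzRingType) (a : A) (b : B)
    (u : {rmorphism {laurent A} -> {laurent B}})
    (M : diffmod a) (N : diffmod b) (i : M -> N) : Prop :=
  is_base_change u i /\ forall m, nabla (i m) = i (nabla m).

(* The convex polygon, unbounded above, with rightmost vertex (mu, 0) and with
   sides of slopes slope j (j < s), where the side of slope sigma has horizontal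
   length \sum_(j | slope j == sigma) len j. *)
Section Polygon.
Variables (R : realType) (mu s : nat) (slope : 'I_s -> R) (len : 'I_s -> nat).

(* By convexity, the side of slope sigma lies over [side_left, side_right]. *)
Definition side_left (sigma : R) : R := (\sum_(j | slope j < sigma) len j)%:R.
Definition side_right (sigma : R) : R := (\sum_(j | slope j <= sigma) len j)%:R.

(* The opposite of the total rise of the sides over [t, mu]. *)
Definition lower_boundary (t : R) : R :=
  - \sum_(sigma <- undup (codom slope))
      sigma * Num.max 0 (side_right sigma - Num.max t (side_left sigma)).

Definition polygon : set (R * R) :=
  [set p | 0 <= p.1 <= mu%:R /\ lower_boundary p.1 <= p.2].
End Polygon.

(* The inclusion K((x)) -> K'((t)), t^(e+1) = x. *)
Definition ram_ext (K : fieldType) (K' : splittingFieldType K) (e : nat) :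
    {rmorphism {laurent K} -> {laurent K'}} :=
  @ram K' e \o lmap (GRing.in_alg K').

(* Gamma is the Newton polygon of N, read off a Turrittin-Levelt decomposition
   of N over a finite Galois extension F' = K'((t)), t = x^(1/e.+1), of K((x)).
   On F' the derivation x d/dx is (e.+1)^-1 t d/dt. *)
Definition newton_polygon (R : realType) (K : fieldType) (N : diffmod (1 : K))
    (Gamma : set (R * R)) : Prop :=
  exists (mu : nat) (K' : splittingFieldType K) (e : nat)
         (N' : diffmod (e.+1%:R^-1 : K')) (i : N -> N')
         (s : nat) (phi : 'I_s -> {laurent K'}) (d : 'I_s -> nat)
         (Reg : 'I_s -> diffmod (e.+1%:R^-1 : K'))
         (h : forall j, {linear Reg j -> N'}),
  [/\ has_dim N mu,
      galois 1%AS {:K'} /\ (exists z : K', e.+1.-primitive_root z),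
      is_diff_base_change (ram_ext K' e) i,
      [/\ injective phi, forall j, polar (phi j) & forall j, regular (Reg j) (d j)] &
      [/\ forall j v, nabla (h j v) = h j (twist (phi j) v),
          forall v : N', exists r : forall j, Reg j, v = \sum_j h j (r j) /\
            forall r' : forall j, Reg j, v = \sum_j h j (r' j) -> forall j, r' j = r j &
          Gamma = polygon mu (fun j => (pole_order (phi j))%:R / e.+1%:R) d]].

Definition is_specialization (A : comNzRingType) (M : diffmod (1 : A))
    (P : prime_idealr A) (N : diffmod (1 : residue_field P)) (i : M -> N) : Prop :=
  is_diff_base_change (lmap (to_residue P)) i.

Definition is_generic_fibre (A : idomainType) (M : diffmod (1 : A))
    (N : diffmod (1 : {fraction A})) (i : M -> N) : Prop :=
  is_diff_base_change (lmap (@FracField.tofrac A)) i.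

(* Main.v *)
Require Import Defs.
From HB Require Import structures.
From mathcomp Require Import all_boot all_order all_fingroup all_algebra all_field.
From mathcomp Require Import boolp classical_sets functions cardinality fsbigop.
From mathcomp Require Import reals.
From mathcomp Require Import zify ring lra.

Set Implicit Arguments.
Unset Strict Implicit.
Unset Printing Implicit Defensive.

Import Order.TTheory GRing.Theory Num.Theory.
Local Open Scope classical_set_scope.
Local Open Scope ring_scope.

(** The Newton polygon is governed by the growth of minors of iterated
    derivatives, and orders of Laurent series can only increase when their
    coefficients are reduced modulo P.

    Present M as a direct summand of A((x))^n: generators g_l and a linear
    section s into A((x))^n ([projective_frame]). For k pairs (j_a, l_a) and k
    columns, form the k x k minor of the vectors s (nabla^(j_a) g_(l_a)). It is
    an element of A((x)), and its images in K((x)) and kappa_P((x)) are the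
    corresponding minors for MK and MP. A coefficient which is nonzero in
    kappa_P is nonzero in A, hence in K: a minor over kappa_P never has a worse
    pole than the same minor over K.

    After the ramified extension over which a fibre decomposes, there is a basis
    (b_i) with nabla b_i = phi_i b_i + (integral terms in the same block). Write
    q_i for the pole order of phi_i. The coordinates of nabla^j v on b_i have
    poles of order at most j q_i + O(1), so that every minor with all j_a <= N
    has a pole of order at most N (q_(f 1) + ... + q_(f k)) + O(1) for some
    injective choice f of k basis vectors ([minor_order]). Conversely, when the
    q_(f a) are positive, the leading term of nabla^N b_i is phi_i^N b_i, so the
    bound N (q_(f 1) + ... + q_(f k)) is reached up to O(1) by some such minor
    ([minor_pole]). Dividing by N and by the ramification index, any sum of k
    positive slopes of MP is at most some sum of k slopes of MK
    ([sum_slopes_le]). The minors of the generators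
    themselves compare the ranks ([fibre_dim_le], [fibre_rank_le]).

    The length-weighted sum of max(0, slope - sigma) is thus at most as large
    for MP as for MK, for every sigma >= 0 ([excess_le]). This function of sigma
    is, up to an affine change of variables, the convex conjugate of the boundary
    of the polygon ([boundary_ge], [boundary_le]), whence the inclusion of the polygons ([polygon_sub]). *)

(** * Orders of Laurent series *)

Definition order_ge (A : zmodType) (m : int) (f : {laurent A}) : Prop :=
  forall n : int, n < m -> f n = 0.

Section Orders.
Variable A : comNzRingType.
Implicit Types f g : {laurent A}.

Lemma laurent_coefD f g n : (f + g) n = f n + g n.
Proof. by []. Qed.

Lemma laurent_coef_sum (I : Type) (r : seq I) (P : pred I) (F : I -> {laurent A}) n :
  (\sum_(i <- r | P i) F i) n = \sum_(i <- r | P i) F i n.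
Proof. by elim/big_rec2: _ => // i x y _ <-. Qed.

Lemma coefM_neq0 f g (n : int) : (f * g) n != 0 ->
  exists i : int, f i != 0 /\ g (n - i) != 0.
Proof.
move=> fgn; apply: contrapT => fg0; case/eqP: fgn; rewrite /= /conv.
rewrite fsbig1 => // i _.
have [->|fi] := eqVneq (f i) 0; first by rewrite mul0r.
have [->|gi] := eqVneq (g (n - i)) 0; first by rewrite mulr0.
by case: fg0; exists i.
Qed.

Lemma order_ge_coef f m n : order_ge m f -> f n != 0 -> m <= n.
Proof. by move=> fm; rewrite leNgt; apply: contra => /fm ->. Qed.

Lemma order_geW f m n : m <= n -> order_ge n f -> order_ge m f.
Proof. by move=> mn fn k km; apply: fn; apply: lt_le_trans mn. Qed.

Lemma order_ge0 m : order_ge m (0 : {laurent A}).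
Proof. by []. Qed.

Lemma order_geD f g m : order_ge m f -> order_ge m g -> order_ge m (f + g).
Proof. by move=> fm gm n nm /=; rewrite fm ?gm ?addr0. Qed.

Lemma order_ge_sum (I : Type) (r : seq I) (P : pred I) (F : I -> {laurent A}) m :
  (forall i, P i -> order_ge m (F i)) -> order_ge m (\sum_(i <- r | P i) F i).
Proof. by move=> Fm; elim/big_ind: _ => // *; exact: order_geD. Qed.

Lemma order_geM f g m n : order_ge m f -> order_ge n g -> order_ge (m + n) (f * g).
Proof.
move=> fm gn k kmn; apply/eqP; rewrite -[_ == _]negbK; apply/negP.
by move=> /coefM_neq0[i [/(order_ge_coef fm) mi /(order_ge_coef gn)]]; lia.
Qed.

Lemma order_ge1 : order_ge 0 (1 : {laurent A}).
Proof. by move=> n n0 /=; case: eqP => // n00; lia. Qed.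

Lemma order_ge_prod (I : Type) (r : seq I) (F : I -> {laurent A}) (m : I -> int) :
  (forall i, order_ge (m i) (F i)) ->
  order_ge (\sum_(i <- r) m i) (\prod_(i <- r) F i).
Proof.
by move=> Fm; elim/big_rec2: _ => [|i x y _]; [exact: order_ge1|exact: order_geM].
Qed.

Lemma order_geX f (m : int) k : order_ge m f -> order_ge (m *+ k) (f ^+ k).
Proof.
move=> fm; elim: k => [|k IH]; first exact: order_ge1.
by rewrite exprS mulrS; apply: order_geM.
Qed.

Lemma order_ge_nat m k : m <= 0 -> order_ge m (k%:R : {laurent A}).
Proof.
move=> m0; apply: (order_geW m0); elim: k => [|k IH]; first exact: order_ge0.
by rewrite mulrS; apply: order_geD => //; exact: order_ge1.
Qed.

Lemma order_ge_euler c f m : order_ge m f -> order_ge m (euler c f).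
Proof. by move=> fm n /fm /= ->; rewrite mul0rz mulr0. Qed.

Lemma order_ge_pole f : order_ge (- (pole_order f)%:Z) f.
Proof. by rewrite /pole_order; case: ex_minnP => q /asboolP. Qed.

Lemma pole_coef_neq0 f : (0 < pole_order f)%N -> f (- (pole_order f)%:Z) != 0.
Proof.
rewrite /pole_order; case: ex_minnP => -[//|q] /asboolP fq qmin _.
apply/eqP => f0; suff /qmin : `[< low_bound f q >] by rewrite ltnn.
apply/asboolP => n nq; have [->//|/eqP nE] := eqVneq n (- q.+1%:Z).
by apply: fq; lia.
Qed.

Lemma coefM_lowest f g m n : order_ge m f -> order_ge n g ->
  (f * g) (m + n) = f m * g n.
Proof.
move=> fm gn; rewrite [LHS](fsbigE [:: m]) //.
  by rewrite big_cons big_nil in_setT /= [m + n]addrC addrK addr0.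
move=> i _; rewrite inE => /eqP im; have [lt_im|le_mi] := ltP i m.
  by rewrite fm ?mul0r.
by rewrite gn ?mulr0 //; lia.
Qed.

Lemma coef_prod_lowest (I : Type) (r : seq I) (F : I -> {laurent A}) (m : I -> int) :
  (forall i, order_ge (m i) (F i)) ->
  (\prod_(i <- r) F i) (\sum_(i <- r) m i) = \prod_(i <- r) F i (m i).
Proof.
move=> Fm; elim: r => [|i r IH]; first by rewrite !big_nil.
by rewrite !big_cons coefM_lowest ?IH //; exact: order_ge_prod.
Qed.

(** The orders depend on the row only, so every term of the expansion of the
    determinant has order at least the sum of the m a. *)
Lemma coef_det_lowest k (X : 'M[{laurent A}]_k) (m : 'I_k -> int) :
  (forall a b, order_ge (m a) (X a b)) ->
  (\det X) (\sum_a m a) = \det (\matrix_(a, b) X a b (m a)).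
Proof.
move=> Xm; rewrite laurent_coef_sum; apply: eq_bigr => s _.
under [in RHS]eq_bigr do rewrite mxE.
by rewrite -coef_prod_lowest //; case: (odd_perm s); rewrite ?mulN1r ?mul1r.
Qed.

Lemma finite_order_bound (T : finType) (F : T -> {laurent A}) :
  exists C : nat, forall t, order_ge (- C%:Z) (F t).
Proof.
exists (\max_t pole_order (F t)) => t.
have tC : - (\max_t pole_order (F t))%:Z <= - (pole_order (F t))%:Z.
  by rewrite lerN2 lez_nat; exact: leq_bigmax.
exact: order_geW tC (@order_ge_pole (F t)).
Qed.
End Orders.

(** * Minors in coordinates *)

(** Multilinear form of the Cauchy-Binet formula: f ranges over all functions,
    the non-injective ones giving vanishing minors. *)
Lemma det_sum_rows (R : comNzRingType) (I : finType) k
    (X : 'I_k -> I -> R) (Y : I -> 'I_k -> R) :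
  \det (\matrix_(a, b) \sum_i X a i * Y i b) =
  \sum_(f : {ffun 'I_k -> I}) (\prod_a X a (f a)) * \det (\matrix_(a, b) Y (f a) b).
Proof.
rewrite [LHS](_ : _ = \sum_(s : 'S_k) \sum_(f : {ffun 'I_k -> I})
    (-1) ^+ s * \prod_a (X a (f a) * Y (f a) (s a))).
  rewrite exchange_big; apply: eq_bigr => f _; rewrite mulr_sumr.
  apply: eq_bigr => s _; rewrite big_split /= mulrCA; do 2!congr (_ * _).
  by apply: eq_bigr => a _; rewrite mxE.
apply: eq_bigr => s _; rewrite -mulr_sumr.
rewrite -(bigA_distr_bigA (fun a i => X a i * Y i (s a))) /=.
by congr (_ * _); apply: eq_bigr => a _; rewrite mxE.
Qed.

Lemma det_sum_cols (R : comNzRingType) (I : finType) k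
    (X : 'I_k -> I -> R) (Y : I -> 'I_k -> R) :
  \det (\matrix_(a, b) \sum_i X a i * Y i b) =
  \sum_(f : {ffun 'I_k -> I}) (\prod_b Y (f b) b) * \det (\matrix_(a, b) X a (f b)).
Proof.
rewrite -det_tr.
rewrite (_ : _^T = \matrix_(a, b) \sum_i (fun a i => Y i a) a i * (fun i b => X b i) i b).
  rewrite det_sum_rows; apply: eq_bigr => f _; congr (_ * _).
  by rewrite -det_tr; congr (\det _); apply/matrixP => a b; rewrite !mxE.
by apply/matrixP => a b; rewrite !mxE; under eq_bigr do rewrite mulrC.
Qed.

Section Coordinates.
Variables (R : comNzRingType) (V : lmodType R).

Definition coordinates (I : finType) (b : I -> V) (co : V -> I -> R) : Prop :=
  (forall v, v = \sum_i co v i *: b i) /\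
  (forall x i, co (\sum_i x i *: b i) i = x i).

(** A frame presents V as a direct summand of a free module: the vectors g
    generate V, and s chooses coefficients linearly. *)
Definition frame n (g : 'I_n -> V) (s : {linear V -> 'rV[R]_n}) : Prop :=
  forall v, v = \sum_l s v 0 l *: g l.

(** The minors play the part of coordinates on the exterior powers of V. *)
Definition minor n (s : V -> 'rV[R]_n) k (v : 'I_k -> V) (c : 'I_k -> 'I_n) : R :=
  \det (\matrix_(a, b) s (v a) 0 (c b)).

Lemma basis_coordinates n (b : 'I_n -> V) :
  is_basis b -> exists co, coordinates b co.
Proof.
move=> bB; have [co coP] := choice bB; exists (fun v i => co v 0 i).
split=> [v|x i]; first by case: (coP v).
have [_ /(_ (\row_i x i))] := coP (\sum_i x i *: b i).
by move=> ->; [rewrite mxE|apply: eq_bigr => j _; rewrite mxE].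
Qed.

Section Basis.
Variables (I : finType) (b : I -> V) (co : V -> I -> R).
Hypothesis bco : coordinates b co.

Lemma coD u v i : co (u + v) i = co u i + co v i.
Proof.
rewrite [u in LHS]bco.1 [v in LHS]bco.1 -big_split /=.
by under eq_bigr do rewrite -scalerDl; rewrite bco.2.
Qed.

Lemma co0 i : co 0 i = 0.
Proof. by apply: (addIr (co 0 i)); rewrite -coD !add0r. Qed.

Lemma coZ x v i : co (x *: v) i = x * co v i.
Proof.
rewrite [v in LHS]bco.1 scaler_sumr.
by under eq_bigr do rewrite scalerA; rewrite bco.2.
Qed.

Lemma co_sum (T : Type) (r : seq T) (y : T -> V) i :
  co (\sum_(t <- r) y t) i = \sum_(t <- r) co (y t) i.
Proof. by apply: (big_morph (co ^~ i)) => [u v|]; rewrite ?coD ?co0. Qed.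

Lemma co_basis i j : co (b i) j = (i == j)%:R.
Proof.
rewrite -[RHS](bco.2 (fun j => (i == j)%:R)); congr (co _ j).
rewrite (bigD1 i) //= eqxx scale1r big1 ?addr0 // => j' /negPf.
by rewrite eq_sym => ->; rewrite scale0r.
Qed.

Variables (n : nat) (g : 'I_n -> V) (s : {linear V -> 'rV[R]_n}).
Hypothesis gs : frame g s.

Lemma minor_basis k (v : 'I_k -> V) c :
  minor s v c = \sum_(f : {ffun 'I_k -> I})
    (\prod_a co (v a) (f a)) * minor s (b \o f) c.
Proof.
rewrite -(det_sum_rows (fun a => co (v a)) (fun i y => s (b i) 0 (c y))).
congr (\det _); apply/matrixP => a y; rewrite !mxE [v a in LHS]bco.1 linear_sum.
by rewrite summxE; apply: eq_bigr => i _; rewrite linearZ !mxE.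
Qed.

Lemma minor_inj k (f : 'I_k -> I) c : minor s (b \o f) c != 0 -> injective f.
Proof.
move=> m0 x y fxy; apply/eqP; apply: contraNT m0 => xy.
by apply/eqP/(determinant_alternate xy) => j; rewrite !mxE /= fxy.
Qed.

Lemma coord_minor_frame k (v : 'I_k -> V) (f : 'I_k -> I) :
  \det (\matrix_(a, y) co (v a) (f y)) = \sum_(c : {ffun 'I_k -> 'I_n})
    (\prod_y co (g (c y)) (f y)) * minor s v c.
Proof.
rewrite -(det_sum_cols (fun a l => s (v a) 0 l) (fun l y => co (g l) (f y))).
congr (\det _); apply/matrixP => a y; rewrite !mxE [v a in LHS]gs co_sum.
by apply: eq_bigr => l _; rewrite coZ.
Qed.

Lemma coord_minor_sum (T : finType) k (F : 'I_k -> T -> R) (w : T -> V)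
    (f : 'I_k -> I) :
  \det (\matrix_(a, y) co (\sum_t F a t *: w t) (f y)) =
  \sum_(J : {ffun 'I_k -> T})
    (\prod_a F a (J a)) * \det (\matrix_(a, y) co (w (J a)) (f y)).
Proof.
rewrite -(det_sum_rows F (fun t y => co (w t) (f y))).
congr (\det _); apply/matrixP => a y; rewrite !mxE co_sum.
by apply: eq_bigr => l _; rewrite coZ.
Qed.

(** The identity matrix is the matrix of coordinates of the basis itself, so
    one of the minors in which it can be expanded must survive. *)
Lemma basis_minor_neq0 : exists (J c : 'I_#|I| -> 'I_n), minor s (g \o J) c != 0.
Proof.
pose f : 'I_#|I| -> I := enum_val.
have det1 : \det (\matrix_(a, y) co (b (f a)) (f y)) = 1 :> R.
  rewrite -[RHS](det1 _ #|I|); congr (\det _); apply/matrixP => a y.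
  by rewrite !mxE co_basis (inj_eq enum_val_inj).
apply: contrapT => /forallNP m0; have /eqP := oner_neq0 R; apply; rewrite -det1.
have -> : \matrix_(a, y) co (b (f a)) (f y) =
    \matrix_(a, y) co (\sum_l s (b (f a)) 0 l *: g l) (f y).
  by apply/matrixP => a y; rewrite !mxE -gs.
rewrite coord_minor_sum big1 // => J _.
rewrite (coord_minor_frame (g \o J)) [X in _ * X]big1 ?mulr0 // => c _.
have [->|mJ] := eqVneq (minor s (g \o J) c) 0; first by rewrite mulr0.
by case: (m0 J); exists c.
Qed.

(** With more vectors than basis elements, no choice of basis vectors is
    injective and the expansion vanishes. *)
Lemma minor_le_basis k (v : 'I_k -> V) c : minor s v c != 0 -> (k <= #|I|)%N.
Proof.
apply: contraNT; rewrite -ltnNge => Ik; rewrite minor_basis.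
apply/eqP; apply: big1 => f _.
have [->|/minor_inj/leq_card] := eqVneq (minor s (b \o f) c) 0; first by rewrite mulr0.
by rewrite card_ord leqNgt Ik.
Qed.
End Basis.
End Coordinates.

(** * Growth of the iterated derivatives *)

Definition iterates (A : comNzRingType) (c : A) (V : diffmod c) n
    (g : 'I_n -> V) {N : nat} (x : 'I_N.+1 * 'I_n) : V :=
  iter x.1 (@nabla _ _ V) (g x.2).

Lemma nabla_sum (A : comNzRingType) (c : A) (V : diffmod c) (T : Type)
    (r : seq T) (P : pred T) (F : T -> V) :
  nabla (\sum_(t <- r | P t) F t) = \sum_(t <- r | P t) nabla (F t).
Proof.
have nD := connD (nabla_connection V); apply: (big_morph _ nD).
by apply: (addIr (nabla 0)); rewrite -nD !add0r.
Qed.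

Section Growth.
Variables (K : comNzRingType) (c : K) (V : diffmod c).
Variables (I : finType) (b : I -> V) (co : V -> I -> {laurent K}).
Hypothesis bco : coordinates b co.
Variables (phi : I -> {laurent K}) (G : I -> I -> {laurent K}).
Hypothesis nabla_b :
  forall i j, co (nabla (b i)) j = phi i * (i == j)%:R + G j i.
Hypothesis G_int : forall i j, order_ge 0 (G j i).
Hypothesis G_block : forall i j, phi j <> phi i -> G j i = 0.
Variables (n : nat) (g : 'I_n -> V) (s : {linear V -> 'rV[{laurent K}]_n}).
Hypothesis gs : frame g s.

Let q i := pole_order (phi i).

Lemma co_nabla v i : co (nabla v) i =
  euler c (co v i) + phi i * co v i + \sum_j G i j * co v j.
Proof.
rewrite [v in LHS]bco.1 nabla_sum (co_sum bco).
under eq_bigr do rewrite (conn_leibniz (nabla_connection V)) (coD bco) !(coZ bco).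
rewrite big_split /= -addrA; congr (_ + _).
  rewrite (bigD1 i) //= (co_basis bco) eqxx mulr1 big1 ?addr0 // => j /negPf ji.
  by rewrite (co_basis bco) ji mulr0.
under eq_bigr do rewrite nabla_b mulrDr.
rewrite big_split /=; congr (_ + _); last by apply: eq_bigr => j _; exact: mulrC.
rewrite (bigD1 i) //= eqxx mulr1 mulrC big1 ?addr0 // => j /negPf ->.
by rewrite !mulr0.
Qed.

(** Since nabla does not mix blocks with distinct exponents, each step
    deepens the pole of the coordinate on b i by at most q i. *)
Lemma co_iter_order v C : (forall i, order_ge (- C%:Z) (co v i)) ->
  forall j i, order_ge (- (j * q i + C)%:Z) (co (iter j (@nabla _ _ V) v) i).
Proof.
move=> vC; elim=> [|j IH] i; first by rewrite mul0n.
rewrite iterS co_nabla; apply: order_geD; first apply: order_geD.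
- by apply: order_ge_euler; apply: order_geW (IH i); rewrite mulSn; lia.
- by apply: order_geW (order_geM (@order_ge_pole _ _) (IH i)); rewrite /q ?mulSn; lia.
apply: order_ge_sum => i' _.
have [pii'|/eqP/G_block ->] := eqVneq (phi i) (phi i'); last by rewrite mul0r.
have -> : q i = q i' by rewrite /q pii'.
by apply: order_geW (order_geM (@G_int _ _) (IH i')); rewrite mulSn; lia.
Qed.

(** Expand the minor on the basis: each injective choice f of basis vectors
    contributes a product of coordinates bounded by [co_iter_order], times a
    minor which is independent of N. *)
Lemma minor_order k : exists C : nat,
  forall N (J : 'I_k -> 'I_N.+1 * 'I_n) (y : {ffun 'I_k -> 'I_n}) (m : int),
  minor s (iterates g \o J) y m != 0 ->
  exists f : 'I_k -> I, injective f /\ - (N * \sum_a q (f a) + C)%:Z <= m.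
Proof.
have [C1 gC] := finite_order_bound (fun x : 'I_n * I => co (g x.1) x.2).
have [C2 sC] := finite_order_bound
  (fun x : {ffun 'I_k -> I} * {ffun 'I_k -> 'I_n} => minor s (b \o x.1) x.2).
exists (k * C1 + C2)%N => N J y m; rewrite (minor_basis bco) laurent_coef_sum => m0.
have [f fm] : exists f : {ffun 'I_k -> I},
    ((\prod_a co ((iterates g \o J) a) (f a)) * minor s (b \o f) y) m != 0.
  apply: contrapT => /forallNP f0; case/eqP: m0; apply: big1 => f _.
  by apply/eqP; rewrite -[_ == _]negbK; exact/negP.
have fI : injective f.
  apply: (@minor_inj _ _ _ b _ s k f y).
  by apply: contraNneq fm => ->; rewrite mulr0.
exists f; split=> //; have [i [fi mi]] := coefM_neq0 fm.
have := order_ge_coef (@sC (f, y)) mi.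
have := order_ge_coef (@order_ge_prod _ _ _ _ (fun a => - (N * q (f a) + C1)%:Z) _) fi.
rewrite sumrN -(big_morph Posz PoszD (erefl _)) big_split /= sum_nat_const card_ord.
rewrite -big_distrr /=; set S := (\sum_(i < k) q (f i))%N => le1 le2.
suff le3 : - (N * S + k * C1)%:Z <= i by lia.
apply: le1 => a; rewrite /iterates /=.
apply: order_geW (@co_iter_order (g (J a).2) C1 (fun i => @gC (_, i)) _ _).
by rewrite lerN2 lez_nat leq_add2r leq_mul2r -ltnS ltn_ord orbT.
Qed.

(** Differentiating phi i ^ N does not deepen its pole, and the integral matrix G
    does not either; only the multiplication by phi i does. *)
Lemma co_iter_lead i N : (0 < q i)%N -> forall j,
  order_ge (1 - (N * q i)%:Z)
    (co (iter N (@nabla _ _ V) (b i)) j - phi i ^+ N * (i == j)%:R) /\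
  (phi j <> phi i -> co (iter N (@nabla _ _ V) (b i)) j = 0).
Proof.
move=> q0; elim: N => [|N IH] j.
  rewrite expr0 mul1r /= (co_basis bco) subrr; split=> // pji.
  by case: eqVneq pji => // ->.
set v := iter N _ _ in IH; rewrite iterS -/v; split; last first.
  move=> pji; rewrite co_nabla (IH j).2 // mulr0 addr0 big1 => [|j' _].
    by rewrite addr0; apply: laurentP => m /=; rewrite mul0rz mulr0.
  have [pj'i|/eqP pj'i] := eqVneq (phi j') (phi i); last by rewrite (IH j').2 ?mulr0.
  by rewrite G_block ?mul0r // pj'i.
have vN j' : order_ge (- (N * q i)%:Z) (co v j').
  rewrite -[co v j'](subrK (phi i ^+ N * (i == j')%:R)); apply: order_geD.
    by apply: order_geW (IH j').1; lia.
  have := order_geM (@order_geX _ _ _ N (@order_ge_pole _ (phi i)))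
    (@order_ge_nat K 0 (i == j') (lexx _)).
  by apply: order_geW; rewrite /q ?mulSn; lia.
rewrite co_nabla (addrAC (euler _ _)) -[X in order_ge _ X]addrA.
apply: order_geD; last first.
  case: (eqVneq i j) (IH j).1 => [<-|ij]; rewrite ?mulr1 ?mulr0 ?subr0 => rN.
    rewrite exprS -mulrBr.
    by apply: order_geW (order_geM (@order_ge_pole _ _) rN); rewrite /q ?mulSn; lia.
  have [pji|/eqP pji] := eqVneq (phi j) (phi i); last by rewrite (IH j).2 ?mulr0.
  by apply: order_geW (order_geM (@order_ge_pole _ _) rN); rewrite /q pji ?mulSn; lia.
apply: order_geD.
  by apply: order_ge_euler; apply: order_geW (vN j); lia.
apply: order_ge_sum => j' _.
by apply: order_geW (order_geM (@G_int _ _) (vN j')); lia.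
Qed.

(** By the Leibniz rule and because the derivation creates no pole, the
    coefficients have poles bounded independently of N. *)
Lemma iter_nabla_frame (v : V) C : (forall l, order_ge (- C%:Z) (s v 0 l)) ->
  forall N, exists F : nat -> 'I_n -> {laurent K},
    (forall j l, order_ge (- C%:Z) (F j l)) /\
    iter N (@nabla _ _ V) v =
      \sum_(j < N.+1) \sum_l F j l *: iter j (@nabla _ _ V) (g l).
Proof.
move=> vC; elim=> [|N [F [FC FE]]].
  by exists (fun _ => s v 0); split=> [_|]; rewrite ?big_ord1 -?gs.
exists (fun j l => (if (j <= N)%N then euler c (F j l) else 0) +
                   (if j is j'.+1 then F j' l else 0)); split=> [j l|].
  apply: order_geD; first by case: ifP => // _; exact: order_ge_euler.
  by case: j => [|j] //.
rewrite iterS FE nabla_sum.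
under eq_bigr do rewrite nabla_sum; under eq_bigr do under eq_bigr do
  rewrite (conn_leibniz (nabla_connection V)) -iterS.
under [RHS]eq_bigr do under eq_bigr do rewrite scalerDl.
under eq_bigr do rewrite big_split /=; under [RHS]eq_bigr do rewrite big_split /=.
rewrite !big_split /=; congr (_ + _).
  rewrite [RHS]big_ord_recr /= ltnn [X in _ + X]big1 ?addr0 => [|l _]; last first.
    by rewrite scale0r.
  by apply: eq_bigr => j _; rewrite -ltnS ltn_ord.
rewrite [RHS]big_ord_recl /= [X in X + _]big1 ?add0r // => l _.
by rewrite scale0r.
Qed.

(** The matrix of coordinates of the nabla^N (b (f a)) on the b (f y) has the
    diagonal matrix of the phi (f a) ^ N as its leading part, so its determinant
    has a pole of order N (q (f 1) + ... + q (f k)). This determinant is a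
    combination, with coefficients of bounded poles, of minors of iterates of
    the generators; one of them must have such a pole up to a constant. *)
Lemma minor_pole k (f : 'I_k -> I) : injective f -> (forall a, 0 < q (f a))%N ->
  (forall N, \prod_a (phi (f a) (- (q (f a))%:Z)) ^+ N != 0) ->
  exists C : nat, forall N, exists (J : 'I_k -> 'I_N.+1 * 'I_n)
    (y : {ffun 'I_k -> 'I_n}) (m : int),
    minor s (iterates g \o J) y m != 0 /\ m <= - (N * \sum_a q (f a))%:Z + C%:Z.
Proof.
move=> fI q0 phi0.
have [C1 gC] := finite_order_bound (fun x : 'I_n * I => co (g x.1) x.2).
have [C2 sC] := finite_order_bound (fun x : I * 'I_n => s (b x.1) 0 x.2).
exists (k * C1 + k * C2)%N => N; set S := (\sum_a q (f a))%N.
have /choice[F FP] : forall a, exists F : 'I_N.+1 * 'I_n -> {laurent K},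
    (forall x, order_ge (- C2%:Z) (F x)) /\
    iter N (@nabla _ _ V) (b (f a)) = \sum_x F x *: iterates g x.
  move=> a; have [F [FC FE]] :=
    @iter_nabla_frame (b (f a)) C2 (fun l => @sC (f a, l)) N.
  exists (fun x : 'I_N.+1 * 'I_n => F x.1 x.2); split=> [x|]; first exact: FC.
  by rewrite FE pair_bigA.
pose X := \matrix_(a, y) co (iter N (@nabla _ _ V) (b (f a))) (f y).
have phiN a : order_ge (- (N * q (f a))%:Z) (phi (f a) ^+ N).
  have := @order_geX _ _ _ N (@order_ge_pole _ (phi (f a))).
  by apply: order_geW; rewrite /q; lia.
have XN a y : order_ge (- (N * q (f a))%:Z) (X a y).
  rewrite mxE -[co _ _](subrK (phi (f a) ^+ N * (f a == f y)%:R)).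
  apply: order_geD.
    by have := (@co_iter_lead (f a) N (q0 a) (f y)).1; apply: order_geW; lia.
  by have := order_geM (phiN a) (@order_ge_nat K 0 (f a == f y) (lexx _)); rewrite addr0.
have detX : (\det X) (- (N * S)%:Z) != 0.
  have -> : - (N * S)%:Z = \sum_a - (N * q (f a))%:Z.
    by rewrite sumrN -(big_morph Posz PoszD (erefl _)) -big_distrr.
  rewrite coef_det_lowest //.
  rewrite (_ : \matrix_(a, y) _ =
    diag_mx (\row_a (phi (f a) (- (q (f a))%:Z)) ^+ N)).
    by rewrite det_diag; under eq_bigr do rewrite mxE.
  apply/matrixP => a y; rewrite !mxE -[co _ _](subrK (phi (f a) ^+ N * (f a == f y)%:R)).
  rewrite laurent_coefD (@co_iter_lead (f a) N (q0 a) (f y)).1 ?add0r; last by lia.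
  rewrite (inj_eq fI); case: eqVneq => _; rewrite ?mulr0 ?mulr1 ?mulr0n ?mulr1n //.
  elim: N {F FP X phiN XN} => [|N IH]; first by rewrite !expr0.
  rewrite !exprS -IH (_ : - _ = - (q (f a))%:Z + - (N * q (f a))%:Z); last by lia.
  apply: coefM_lowest; first exact: order_ge_pole.
  have := @order_geX _ _ _ N (@order_ge_pole _ (phi (f a))).
  by apply: order_geW; rewrite /q; lia.
move: detX; rewrite /X.
have -> : \matrix_(a, y) co (iter N (@nabla _ _ V) (b (f a))) (f y) =
    \matrix_(a, y) co (\sum_x F a x *: iterates g x) (f y).
  by apply/matrixP => a y; rewrite !mxE (FP a).2.
rewrite (coord_minor_sum bco) laurent_coef_sum => m0.
have [J Jm] : exists J : {ffun 'I_k -> 'I_N.+1 * 'I_n},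
    ((\prod_a F a (J a)) * \det (\matrix_(a, y) co (iterates g (J a)) (f y)))
      (- (N * S)%:Z) != 0.
  apply: contrapT => /forallNP J0; case/eqP: m0; apply: big1 => J _.
  by apply/eqP; rewrite -[_ == _]negbK; exact/negP.
have [i [Fi mi]] := coefM_neq0 Jm.
move: mi; rewrite (coord_minor_frame bco gs (iterates g \o J)) laurent_coef_sum => m0'.
have [y ym] : exists y : {ffun 'I_k -> 'I_n},
    ((\prod_z co (g (y z)) (f z)) * minor s (iterates g \o J) y) (- (N * S)%:Z - i) != 0.
  apply: contrapT => /forallNP y0; case/eqP: m0'; apply: big1 => y _.
  by apply/eqP; rewrite -[_ == _]negbK; exact/negP.
have [i' [Gi mi']] := coefM_neq0 ym.
exists J, y, (- (N * S)%:Z - i - i'); split=> //.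
have := order_ge_coef (@order_ge_prod _ _ _ _ (fun=> - C1%:Z)
  (fun z => @gC (y z, f z))) Gi.
have := order_ge_coef (@order_ge_prod _ _ _ _ (fun=> - C2%:Z)
  (fun a => (FP a).1 (J a))) Fi.
rewrite !sumrN -!(big_morph Posz PoszD (erefl _)) !sum_nat_const card_ord.
lia.
Qed.
End Growth.

(** * Extension of scalars *)

Lemma projective_frame (R : comNzRingType) (M : lmodType R) : fg_projective M ->
  exists n (g : 'I_n -> M) (s : {linear M -> 'rV[R]_n}), frame g s.
Proof.
move=> [n [p [s sK]]]; exists n, (fun l => p (delta_mx 0 l)), s => v.
rewrite -[LHS]sK [s v in LHS]row_sum_delta linear_sum.
by apply: eq_bigr => l _; rewrite linearZ.
Qed.

Section Combination.
Variables (R : comNzRingType) (M : lmodType R) (n : nat) (g : 'I_n -> M).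

Definition combination (x : 'rV[R]_n) : M := \sum_l x 0 l *: g l.

Fact combination_is_linear : linear combination.
Proof.
move=> a x y; rewrite /combination scaler_sumr -big_split /=.
by apply: eq_bigr => l _; rewrite !mxE scalerDl scalerA.
Qed.
HB.instance Definition _ := GRing.isLinear.Build R 'rV[R]_n M _ combination
  combination_is_linear.
End Combination.

(** The section extends by the universal property; the identity of N and the
    combination of the generators with coefficients s' agree on the image of i,
    hence everywhere by uniqueness. *)
Lemma frame_base_change (R S : comNzRingType) (u : {rmorphism R -> S})
    (M : lmodType R) (N : lmodType S) (i : M -> N) n
    (g : 'I_n -> M) (s : {linear M -> 'rV[R]_n}) :
  is_base_change u i -> frame g s ->
  exists s' : {linear N -> 'rV[S]_n},
    frame (i \o g) s' /\ forall m, s' (i m) = map_mx u (s m).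
Proof.
move=> [[iD iZ] univ] gs.
have [] := univ _ (map_mx u \o s : M -> 'rV[S]_n).
  by split=> [x y|a x] /=; rewrite ?linearD ?linearZ ?map_mxD ?map_mxZ.
move=> s' [s'i _]; exists s'; split; last exact: s'i.
have {}s'i m : s' (i m) = map_mx u (s m) := s'i m.
have [h [_ huniq]] := univ _ i (conj iD iZ).
move=> v; have -> : \sum_l s' v 0 l *: (i \o g) l = combination (i \o g) (s' v) by [].
have h1 : combination (i \o g) \o s' =1 h.
  apply: huniq => m; rewrite [LHS]/= s'i [in RHS](gs m) /combination /=.
  rewrite (big_morph i iD (_ : i 0 = 0)) => [|]; last first.
    by rewrite -(scale0r 0) iZ rmorph0 scale0r.
  by apply: eq_bigr => l _; rewrite iZ mxE.
have -> : combination (i \o g) (s' v) = h v := h1 v.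
by rewrite -(huniq idfun).
Qed.

Lemma minor_map (R S : comNzRingType) (u : {rmorphism R -> S})
    (M : lmodType R) (N : lmodType S) (i : M -> N) n
    (s : M -> 'rV[R]_n) (s' : N -> 'rV[S]_n) k (v : 'I_k -> M) y :
  (forall m, s' (i m) = map_mx u (s m)) -> minor s' (i \o v) y = u (minor s v y).
Proof.
move=> s'i; rewrite /minor -det_map_mx; congr (\det _).
by apply/matrixP => a z; rewrite !mxE /= s'i mxE.
Qed.

Lemma iterates_map (A B : comNzRingType) (a : A) (c : B)
    (M : diffmod a) (N : diffmod c) (i : M -> N) n (g : 'I_n -> M) D
    (x : 'I_D.+1 * 'I_n) :
  (forall m, nabla (i m) = i (nabla m)) -> iterates (i \o g) x = i (iterates g x).
Proof.
by move=> inabla; rewrite /iterates; elim: (x.1 : nat) => //= j ->; exact: inabla.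
Qed.

(** * Turrittin-Levelt bases *)

Section Turrittin.
Variables (K : comNzRingType) (c : K) (N : diffmod c).
Variables (r : nat) (phi : 'I_r -> {laurent K}) (d : 'I_r -> nat).
Variables (Reg : 'I_r -> diffmod c) (h : forall j, {linear Reg j -> N}).
Hypothesis reg : forall j, regular (Reg j) (d j).
Hypothesis nabla_h : forall j v, nabla (h j v) = h j (twist (phi j) v).
Hypothesis direct_sum : forall v : N, exists x : forall j, Reg j,
  v = \sum_j h j (x j) /\
  forall x' : forall j, Reg j, v = \sum_j h j (x' j) -> forall j, x' j = x j.

Let I : finType := {j : 'I_r & 'I_(d j)}.

(** The bases of the regular summands together form a basis of N; G collects the
    integral matrices of the summands and is block diagonal. *)
Lemma turrittin_basis : exists (b : I -> N) (co : N -> I -> {laurent K})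
    (G : I -> I -> {laurent K}),
  [/\ coordinates b co,
      forall i j, co (nabla (b i)) j = phi (tag i) * (i == j)%:R + G j i,
      forall i j, order_ge 0 (G j i) &
      forall i j, phi (tag j) <> phi (tag i) -> G j i = 0].
Proof.
pose B j := sval (cid (reg j)); pose Gam j := sval (cid (svalP (cid (reg j)))).
have BP j : [/\ is_basis (B j), forall k, nabla (B j k) = \sum_l Gam j l k *: B j l
    & forall l k, integral_series (Gam j l k)] := svalP (cid (svalP (cid (reg j)))).
have Bco j : exists co, coordinates (B j) co by case: (BP j) => /basis_coordinates.
pose coB j := sval (cid (Bco j)).
have coBP j : coordinates (B j) (coB j) := svalP (cid (Bco j)).
pose X v := sval (cid (direct_sum v)).
have XP v : v = \sum_j h j (X v j) /\
    forall x' : forall j, Reg j, v = \sum_j h j (x' j) -> forall j, x' j = X v j.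
  exact: svalP (cid (direct_sum v)).
pose b (p : I) := h (tag p) (B (tag p) (tagged p)).
have bco : coordinates b (fun v p => coB (tag p) (X v (tag p)) (tagged p)).
  split=> [v|x p].
    rewrite [LHS](XP v).1.
    under eq_bigr do rewrite [X v _](coBP _).1 linear_sum.
    rewrite sig_big_dep; apply: eq_bigr => -[j a] _.
    by rewrite linearZ.
  have /(XP _).2/(_ (tag p)) <- : \sum_p x p *: b p =
      \sum_j h j (\sum_a x (Tagged (fun j => 'I_(d j)) a) *: B j a).
    under [RHS]eq_bigr do rewrite linear_sum.
    rewrite sig_big_dep; apply: eq_bigr => -[j a] _.
    by rewrite linearZ.
  by rewrite (coBP _).2 taggedK.
exists b, (fun v p => coB (tag p) (X v (tag p)) (tagged p)).
exists (fun j i => \sum_l Gam (tag i) l (tagged i) *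
  (Tagged (fun j => 'I_(d j)) l == j)%:R); split=> //.
- move=> [i a] j; rewrite nabla_h /twist linearD linearZ /=.
  have [_ -> _] := BP i; rewrite (coD bco) (coZ bco) (co_basis bco (existT _ i a)).
  congr (_ + _); rewrite linear_sum (co_sum bco); apply: eq_bigr => l _.
  by rewrite linearZ (coZ bco) (co_basis bco (existT _ i l)).
- move=> [i a] j; apply: order_ge_sum => l _.
  have [_ _ /(_ l a) Gint] := BP i.
  by rewrite -[0]addr0; apply: order_geM => //; exact: order_ge_nat.
- move=> [i a] j /= pji; apply: big1 => l _.
  by case: eqP pji => [<-|_] //; rewrite mulr0.
Qed.
End Turrittin.

(** * Newton polygons and truncated sums of slopes *)

Section PolygonDuality.
Variables (R : realType) (r : nat) (slope : 'I_r -> R) (len : 'I_r -> nat).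
Hypothesis slope_ge0 : forall j, 0 <= slope j.

(** As a function of sigma, this is the irregularity beyond slope sigma, and, up to
    an affine change of variables, the convex conjugate of the boundary of the
    polygon. *)
Definition excess (sigma : R) : R :=
  \sum_j (len j)%:R * Num.max 0 (slope j - sigma).

Let total : R := (\sum_j len j)%:R.
Let left := side_left slope len.
Let right := side_right slope len.
Let sides : seq R := undup (codom slope).
Let part (t sigma : R) : R := Num.max 0 (right sigma - Num.max t (left sigma)).

Lemma part_ge0 t sigma : 0 <= part t sigma.
Proof. by rewrite le_max lexx. Qed.

Lemma side_lengthE sigma :
  right sigma - left sigma = (\sum_(j | slope j == sigma) len j)%:R.
Proof.
rewrite /right /left /side_right /side_left (bigID (fun j => slope j == sigma)) /=.
rewrite (eq_bigl (fun j => slope j == sigma)) => [|j]; last first.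
  by case: eqVneq => [->|]; rewrite ?lexx ?andbF.
rewrite [X in (_ + X)%N](eq_bigl (fun j => slope j < sigma)) => [|j].
  by rewrite natrD addrK.
by rewrite lt_neqAle andbC.
Qed.

Lemma left_le_right sigma : left sigma <= right sigma.
Proof. by rewrite -subr_ge0 side_lengthE. Qed.

Lemma sum_sides (F : R -> R) :
  \sum_(sigma <- sides) F sigma * (right sigma - left sigma) =
  \sum_j (len j)%:R * F (slope j).
Proof.
under eq_bigr do rewrite side_lengthE natr_sum mulr_sumr.
rewrite (exchange_big_dep predT) //=; apply: eq_bigr => j _.
rewrite big_mkcond (bigD1_seq (slope j)) ?undup_uniq //=; last first.
  by rewrite mem_undup; exact: codom_f.
rewrite eqxx big1 ?addr0 1?mulrC // => sigma /negPf.
by rewrite eq_sym => ->.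
Qed.

Lemma right_le_left sigma tau : sigma < tau -> right sigma <= left tau.
Proof.
move=> st; rewrite ler_nat [leqRHS](bigID (fun j => slope j <= sigma)) /=.
rewrite [X in (_ <= X + _)%N](eq_bigl (fun j => slope j <= sigma)) ?leq_addr //.
by move=> j; apply: andb_idl => js; exact: le_lt_trans js st.
Qed.

Lemma right_pred sigma tau : sigma < tau ->
  (forall j, slope j < tau -> slope j <= sigma) -> left tau = right sigma.
Proof.
move=> st h; apply/eqP; rewrite eq_le right_le_left // andbT ler_nat.
rewrite (eq_bigl (fun j => slope j <= sigma)) // => j.
by apply/idP/idP => [/h //|js]; exact: le_lt_trans js st.
Qed.

Lemma partE t sigma :
  part t sigma = Num.max 0 (right sigma - t) - Num.max 0 (left sigma - t).
Proof.
have lr := left_le_right sigma; rewrite /part !maxElt.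
by case: (ltP t (left sigma)) => lt; do ?[case: ltP => ?]; lra.
Qed.

(** Sorted by slope, the sides abut, so that their parts beyond t telescope. *)
Lemma sum_part (t : R) : 0 <= t ->
  \sum_(sigma <- sides) part t sigma = Num.max 0 (total - t).
Proof.
move=> t0; pose psi (x : R) := Num.max 0 (x - t).
have tele S sigma : path <%R sigma S -> (forall j, sigma < slope j -> slope j \in S) ->
    \sum_(tau <- S) part t tau = psi total - psi (right sigma).
  elim: S sigma => [|tau S IH] sigma /=.
    move=> _ h; rewrite big_nil (_ : right sigma = total) ?subrr //.
    congr (_ %:R); apply: eq_bigl => j; rewrite leNgt.
    by case: ltP => // /h; rewrite in_nil.
  move=> /andP[st tS] h; rewrite big_cons (IH tau) //; last first.
    move=> j tj; have := h j (lt_trans st tj).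
    by rewrite in_cons => /orP[/eqP jt|//]; rewrite jt ltxx in tj.
  rewrite partE (@right_pred sigma tau) // => [|j jt]; first by rewrite /psi; ring.
  rewrite leNgt; apply/negP => /h; rewrite in_cons => /orP[/eqP jE|jS].
    by rewrite jE ltxx in jt.
  have /allP/(_ _ jS) := order_path_min lt_trans tS.
  by move=> /(lt_trans jt); rewrite ltxx.
rewrite -(perm_big _ (permEl (perm_sort <=%R _))) /= (tele _ (-1)) //.
- rewrite [X in _ - X](max_idPl _) ?subr0 // /right /side_right.
  rewrite big_pred0 ?sub0r ?oppr_le0 //.
  by move=> j; apply/negbTE; rewrite -ltNge; apply: lt_le_trans (slope_ge0 j); lra.
- rewrite path_min_sorted.
    by rewrite lt_sorted_uniq_le sort_uniq undup_uniq sort_sorted //; exact: le_total.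
  apply/allP => x; rewrite mem_sort mem_undup => /codomP[j ->].
  by apply: lt_le_trans (slope_ge0 j); lra.
- by move=> j _; rewrite mem_sort mem_undup; exact: codom_f.
Qed.

Lemma part_le_length t sigma : part t sigma <= right sigma - left sigma.
Proof.
rewrite /part ge_max subr_ge0 left_le_right lerD2l lerN2 le_max lexx orbT //.
Qed.

(** On each side, sigma <= max(0, sigma - sigma0) + sigma0; the first term is
    summed over the whole side and the second over its part beyond t. *)
Lemma boundary_ge (t sigma0 : R) : 0 <= t -> 0 <= sigma0 ->
  - lower_boundary slope len t <= excess sigma0 + sigma0 * Num.max 0 (total - t).
Proof.
move=> t0 s0; rewrite opprK -sum_part // /excess.
rewrite -(sum_sides (fun sigma => Num.max 0 (sigma - sigma0))) mulr_sumr -big_split /=.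
apply: ler_sum => sigma _; rewrite -/(part t sigma).
have := part_ge0 t sigma; have := part_le_length t sigma.
move: (part t sigma) (right sigma - left sigma) => w l wl w0.
have [ss|ss] := leP 0 (sigma - sigma0).
  have : 0 <= (sigma - sigma0) * (l - w) by rewrite mulr_ge0 // subr_ge0.
  lra.
have : 0 <= (sigma0 - sigma) * w by rewrite mulr_ge0 //; lra.
lra.
Qed.

(** The least slope whose side ends beyond t works: if it began beyond t, the
    preceding side would already end there. *)
Lemma supporting_side (t : R) : 0 <= t -> t < total ->
  exists j, left (slope j) <= t <= right (slope j).
Proof.
move=> t0 tn.
have [j0 _] : exists j : 'I_r, true.
  apply: contrapT => noj; move: tn; rewrite /total big1 ?ltNge ?t0 // => j _.
  by case: noj; exists j.
have [j1 _ j1max] := @arg_maxP _ _ _ j0 xpredT slope isT.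
have j1P : t < right (slope j1).
  suff -> : right (slope j1) = total by [].
  by congr (_%:R); apply: eq_bigl => j; exact: j1max.
have [j jP jmin] := @arg_minP _ _ _ j1 (fun j => t < right (slope j)) slope j1P.
exists j; rewrite (ltW jP) andbT leNgt; apply/negP => tl.
have [i0 i0j] : exists i, slope i < slope j.
  apply: contrapT => /forallNP none; move: tl; rewrite /left /side_left big_pred0.
    by rewrite ltNge t0.
  by move=> i; exact/negP.
have [i ij imax] := @arg_maxP _ _ _ i0 (fun i => slope i < slope j) slope i0j.
have := jmin i; rewrite -(@right_pred (slope i) (slope j)) // => /(_ tl).
by rewrite leNgt ij.
Qed.

(** The slope of the side over t gives equality: steeper sides lie entirely
    beyond t and the other ones before t. For t past all the sides, a value of
    sigma0 larger than every slope makes the left-hand side vanish. *)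
Lemma boundary_le (t : R) : 0 <= t -> exists2 sigma0, 0 <= sigma0 &
  excess sigma0 + sigma0 * Num.max 0 (total - t) <= - lower_boundary slope len t.
Proof.
move=> t0; have side_ge0 sigma : sigma \in sides -> 0 <= sigma.
  by rewrite mem_undup => /codomP[j ->].
have [nt|tn] := leP total t.
  exists (\sum_j slope j); first exact: sumr_ge0.
  rewrite (max_idPl _) ?subr_le0 // mulr0 addr0 opprK /excess big1 => [|j _].
    rewrite big_seq; apply: sumr_ge0 => sigma /side_ge0 s0.
    by rewrite mulr_ge0 // le_max lexx.
  rewrite (max_idPl _) ?mulr0 // subr_le0 (bigD1 j) //= lerDl; exact: sumr_ge0.
have [j /andP[lt tr]] := supporting_side t0 tn.
exists (slope j) => //; rewrite opprK -sum_part // /excess.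
rewrite -(sum_sides (fun sigma => Num.max 0 (sigma - slope j))) mulr_sumr -big_split /=.
rewrite big_seq [leRHS]big_seq.
apply: ler_sum => sigma _; rewrite -/(part t sigma) /part.
have lr := left_le_right sigma.
have [sj|js|->] := ltgtP sigma (slope j).
- have rt : right sigma <= t := le_trans (right_le_left sj) lt.
  have -> : Num.max 0 (sigma - slope j) = 0 by apply/max_idPl; rewrite subr_le0 ltW.
  have -> : Num.max 0 (right sigma - Num.max t (left sigma)) = 0.
    by apply/max_idPl; rewrite subr_le0 le_max rt.
  by rewrite mul0r !mulr0 addr0.
- have /max_idPr -> : t <= left sigma := le_trans tr (right_le_left js).
  have /max_idPr -> : 0 <= sigma - slope j by rewrite subr_ge0 ltW.
  have /max_idPr -> : 0 <= right sigma - left sigma by rewrite subr_ge0.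
  by rewrite -mulrDl subrK.
- by rewrite subrr maxxx mul0r add0r.
Qed.
End PolygonDuality.

Lemma polygon_sub (R : realType) mu mu' r r' (slope : 'I_r -> R) (slope' : 'I_r' -> R)
    len len' :
  (forall j, 0 <= slope j) -> (forall j, 0 <= slope' j) ->
  (mu <= mu')%N -> (\sum_j len j <= \sum_j len' j)%N ->
  (forall sigma, 0 <= sigma -> excess slope len sigma <= excess slope' len' sigma) ->
  polygon mu slope len `<=` polygon mu' slope' len'.
Proof.
move=> s0 s0' mumu nn ee [t z] /= [/andP[t0 tmu] zt]; split.
  by rewrite t0 (le_trans tmu) // ler_nat.
apply: le_trans zt; rewrite -lerN2.
have [sigma sigma0 le2] := boundary_le len' s0' t0; apply: le_trans le2.
apply: le_trans (boundary_ge len s0 t0 sigma0) _.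
apply: lerD; first exact: ee.
apply: ler_wpM2l => //; rewrite ge_max le_max lexx /= le_max; apply/orP; right.
by rewrite lerD2r ler_nat.
Qed.

(** * Fibres of a differential module *)

Lemma basis_index_sum (V : nmodType) r (d : 'I_r -> nat) (F : 'I_r -> V) :
  \sum_(p : {j : 'I_r & 'I_(d j)}) F (tag p) = \sum_j F j *+ d j.
Proof.
rewrite -(@sig_big_dep _ _ _ _ (fun j => 'I_(d j)) xpredT (fun _ _ => true)
  (fun j _ => F j)) /=.
by apply: eq_bigr => j _; rewrite sumr_const card_ord.
Qed.

Lemma card_basis_index r (d : 'I_r -> nat) :
  #|{: {j : 'I_r & 'I_(d j)}}| = (\sum_j d j)%N.
Proof.
rewrite -sum1_card (basis_index_sum d (fun=> 1%N)).
by apply: eq_bigr => j _; rewrite -mulr_natl mulr1 natn.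
Qed.

Section RankOfFibre.
Variables (R S : comNzRingType) (u : {rmorphism R -> S}).
Variables (M : lmodType R) (N : lmodType S) (i : M -> N).
Variables (n : nat) (g : 'I_n -> M) (s : {linear M -> 'rV[R]_n}).
Variable s' : {linear N -> 'rV[S]_n}.
Hypothesis gs' : frame (i \o g) s'.
Hypothesis s'i : forall m, s' (i m) = map_mx u (s m).
Variables (I : finType) (b : I -> N) (co : N -> I -> S).
Hypothesis bco : coordinates b co.

Lemma fibre_rank_attained :
  exists (J : 'I_#|I| -> 'I_n) y, u (minor s (g \o J) y) != 0.
Proof.
have [J [y m0]] := basis_minor_neq0 bco gs'; exists J, y.
rewrite -(minor_map _ _ s'i); exact: m0.
Qed.

Lemma fibre_rank_bound k (v : 'I_k -> M) y : u (minor s v y) != 0 -> (k <= #|I|)%N.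
Proof. by rewrite -(minor_map _ _ s'i); exact: (minor_le_basis bco). Qed.
End RankOfFibre.

Lemma ram_ext_coef (K : fieldType) (K' : splittingFieldType K) e
    (f : {laurent K}) (m : int) :
  ram_ext K' e f m != 0 -> exists2 k : int, m = k * e.+1%:Z & f k != 0.
Proof.
rewrite /= /ramcoef; case: dvdzP => [[k ->]|_]; last by rewrite eqxx.
by rewrite mulzK // => fk; exists k => //; apply: contraNneq fk => ->; rewrite /= scale0r.
Qed.

Lemma ram_ext_coef_neq0 (K : fieldType) (K' : splittingFieldType K) e
    (f : {laurent K}) (k : int) :
  f k != 0 -> ram_ext K' e f (k * e.+1%:Z) != 0.
Proof.
move=> fk; rewrite /= /ramcoef dvdz_mull // mulzK //=.
by rewrite scaler_eq0 oner_eq0 orbF.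
Qed.

(** What the decomposition of one fibre says about the minors of M itself: q and
    d give the pole orders and the dimensions of the summands, e.+1 is the
    ramification index, and mu is the dimension of the fibre. The orders m are
    taken with respect to x, hence the factors e.+1. *)
Record fibre_growth (A : comNzRingType) (M : diffmod (1 : A)) n (g : 'I_n -> M)
    (s : {linear M -> 'rV[{laurent A}]_n}) (K : comNzRingType)
    (u : {rmorphism A -> K}) (mu e r : nat) (q d : 'I_r -> nat) : Prop := {
  dim_attained : exists (J : 'I_mu -> 'I_n) y, lmap u (minor s (g \o J) y) != 0;
  dim_bound : forall k (J : 'I_k -> 'I_n) y,
    lmap u (minor s (g \o J) y) != 0 -> (k <= mu)%N;
  rank_attained : exists (J : 'I_(\sum_j d j) -> 'I_n) y,
    lmap u (minor s (g \o J) y) != 0;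
  rank_bound : forall k (J : 'I_k -> 'I_n) y,
    lmap u (minor s (g \o J) y) != 0 -> (k <= \sum_j d j)%N;
  growth_bound : forall k, exists C : nat,
    forall N (J : 'I_k -> 'I_N.+1 * 'I_n) (y : {ffun 'I_k -> 'I_n}) (m : int),
    lmap u (minor s (iterates g \o J) y) m != 0 ->
    exists f : 'I_k -> {j : 'I_r & 'I_(d j)}, injective f /\
      - (N * \sum_a q (tag (f a)) + C)%:Z <= m * e.+1%:Z;
  growth_attained : forall k (f : 'I_k -> {j : 'I_r & 'I_(d j)}), injective f ->
    (forall a, 0 < q (tag (f a)))%N -> exists C : nat, forall N,
    exists (J : 'I_k -> 'I_N.+1 * 'I_n) (y : {ffun 'I_k -> 'I_n}) (m : int),
    lmap u (minor s (iterates g \o J) y) m != 0 /\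
    m * e.+1%:Z <= - (N * \sum_a q (tag (f a)))%:Z + C%:Z
}.

Lemma newton_polygon_growth (R : realType) (A : comNzRingType) (K : fieldType)
    (u : {rmorphism A -> K}) (M : diffmod (1 : A)) (N : diffmod (1 : K))
    (i : M -> N) n (g : 'I_n -> M) (s : {linear M -> 'rV[{laurent A}]_n})
    (Gamma : set (R * R)) :
  frame g s -> is_diff_base_change (lmap u) i -> newton_polygon N Gamma ->
  exists (mu e r : nat) (q d : 'I_r -> nat), fibre_growth g s u mu e q d /\
    Gamma = polygon mu (fun j => (q j)%:R / e.+1%:R) d.
Proof.
move=> gs [bc ni] [mu [K' [e [N' [i' [r [phi [d [Reg [h]]]]]]]]]].
move=> [[b0 /basis_coordinates[co0 bco0]] _ [bc' ni'] [_ _ reg] [hn dsum ->]].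
exists mu, e, r, (fun j => pole_order (phi j)), d; split=> //.
have [s1 [gs1 s1i]] := frame_base_change bc gs.
have [s2 [gs2 s2i]] := frame_base_change bc' gs1.
have s2ii m : s2 ((i' \o i) m) = map_mx (ram_ext K' e \o lmap u) (s m).
  by rewrite map_mx_comp /= -s1i -s2i.
have nii m : nabla ((i' \o i) m) = (i' \o i) (nabla m) by rewrite /= ni' ni.
have [b [co [G [bco nb Gint Gblock]]]] := turrittin_basis reg hn dsum.
have minorE D k (J : 'I_k -> 'I_D.+1 * 'I_n) y :
    minor s2 (iterates (i' \o i \o g) \o J) y =
    ram_ext K' e (lmap u (minor s (iterates g \o J) y)).
  transitivity (minor s2 ((i' \o i) \o (iterates g \o J)) y); last first.
    exact: (minor_map (u := ram_ext K' e \o lmap u) _ _ s2ii).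
  congr (minor s2 _ y); apply/funext => a /=; exact: (iterates_map (i := i' \o i)).
split.
- have := fibre_rank_attained gs1 s1i bco0; rewrite card_ord => -[J [y m0]].
  by exists J, y.
- move=> k J y m0; have := fibre_rank_bound s1i bco0 m0.
  by rewrite card_ord.
- have := fibre_rank_attained (u := ram_ext K' e \o lmap u) (i := i' \o i) gs2 s2ii bco.
  rewrite card_basis_index => -[J [y m0]].
  exists J, y; apply: contraNneq m0 => m0.
  by apply/eqP; apply: etrans (congr1 (ram_ext K' e) m0) (rmorph0 _).
- move=> k J y m0; rewrite -card_basis_index.
  apply: (fibre_rank_bound (u := ram_ext K' e \o lmap u) s2ii bco (v := g \o J) (y := y)).
  apply: contraNneq m0 => m0; apply/eqP/laurentP => k'.
  apply/eqP; rewrite -[_ == _]negbK; apply/negP => /(ram_ext_coef_neq0 K' e).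
  by rewrite [ram_ext _ _ _]m0 eqxx.
- move=> k; have [C CP] := minor_order bco nb Gint Gblock (i' \o i \o g) s2 k.
  exists C => D J y m /(ram_ext_coef_neq0 K' e); rewrite -minorE; exact: CP.
- move=> k f fI q0.
  have [D|C CP] := minor_pole bco nb Gint Gblock gs2 fI q0.
    apply/prodf_neq0 => a _; rewrite expf_neq0 //; exact: pole_coef_neq0.
  exists C => D; have [J [y [m []]]] := CP D.
  rewrite minorE => /ram_ext_coef[m' -> m'0] mC.
  by exists J, y, m'.
Qed.

(** * Comparison of two fibres *)

Lemma natmul_bounded_le0 (R : realType) (x C : R) :
  (forall N : nat, N%:R * x <= C) -> x <= 0.
Proof.
move=> xC; rewrite leNgt; apply/negP => x0.
have C0 : 0 <= C by have := xC 0%N; rewrite mul0r.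
have /archi_boundP := divr_ge0 C0 (ltW x0).
by rewrite ltr_pdivrMr // ltNge xC.
Qed.

Section Comparison.
Variables (R : realType) (A K K' : comNzRingType) (u : {rmorphism A -> K}).
Variable u' : {rmorphism A -> K'}.
Hypothesis uu' : forall a, u a != 0 -> u' a != 0.
Variables (M : diffmod (1 : A)) (n : nat) (g : 'I_n -> M).
Variable s : {linear M -> 'rV[{laurent A}]_n}.
Variables (mu e r : nat) (q d : 'I_r -> nat).
Variables (mu' e' r' : nat) (q' d' : 'I_r' -> nat).
Hypothesis growth : fibre_growth g s u mu e q d.
Hypothesis growth' : fibre_growth g s u' mu' e' q' d'.

Let lmap_neq0 f : lmap u f != 0 -> lmap u' f != 0.
Proof.
move=> f0; apply: contraNneq f0 => f'0; apply/eqP/laurentP => m.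
have /eqP f'm : lmap u' f m == 0 by rewrite f'0.
by apply/eqP; rewrite -[_ == _]negbK; apply/negP => /uu'; rewrite [u' _]f'm eqxx.
Qed.

Lemma fibre_dim_le : (mu <= mu')%N.
Proof.
have [J [y /lmap_neq0]] := dim_attained growth; exact: dim_bound growth' _ _ _.
Qed.

Lemma fibre_rank_le : (\sum_j d j <= \sum_j d' j)%N.
Proof.
have [J [y /lmap_neq0]] := rank_attained growth; exact: rank_bound growth' _ _ _.
Qed.

Let slope (p : {j : 'I_r & 'I_(d j)}) : R := (q (tag p))%:R / e.+1%:R.
Let slope' (p : {j : 'I_r' & 'I_(d' j)}) : R := (q' (tag p))%:R / e'.+1%:R.

Lemma excessE r0 e0 (q0 d0 : 'I_r0 -> nat) (sigma : R) :
  excess (fun j => (q0 j)%:R / e0.+1%:R) d0 sigma =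
  \sum_(p : {j : 'I_r0 & 'I_(d0 j)}) Num.max 0 ((q0 (tag p))%:R / e0.+1%:R - sigma).
Proof.
rewrite (basis_index_sum d0 (fun j => Num.max 0 ((q0 j)%:R / e0.+1%:R - sigma))).
by apply: eq_bigr => j _; rewrite mulr_natl.
Qed.

(** In both fibres, N times a sum of k slopes measures, up to a constant, the
    largest pole of the minors with iterates up to N; the inequality follows on
    letting N tend to infinity. *)
Lemma sum_slopes_le k (f : 'I_k -> {j : 'I_r & 'I_(d j)}) (T : R) : injective f ->
  (forall a, 0 < q (tag (f a)))%N ->
  (forall f' : 'I_k -> {j : 'I_r' & 'I_(d' j)}, injective f' ->
    \sum_a slope' (f' a) <= T) ->
  \sum_a slope (f a) <= T.
Proof.
move=> fI q0 T_ge; have [C CP] := growth_attained growth fI q0.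
have [C' C'P] := growth_bound growth' k.
rewrite -subr_le0; apply: (@natmul_bounded_le0 _ _ (C%:R + C'%:R)) => N.
have [J [y [m [/uu' m0 mC]]]] := CP N.
have [f' [f'I mC']] := C'P N J y m m0.
have := T_ge f' f'I; rewrite -!mulr_suml -!natr_sum.
move: (\sum_a q _)%N (\sum_a q' _)%N mC mC' => Q Q' mC mC' QT.
have e0 : 1 <= e.+1%:R :> R by rewrite ler1n.
have e'0 : 1 <= e'.+1%:R :> R by rewrite ler1n.
have le1 : N%:R * (Q%:R / e.+1%:R) <= - m%:~R + C%:R :> R.
  rewrite mulrA ler_pdivrMr; last by lra.
  have : (m * e.+1%:Z)%:~R <= (- (N * Q)%:Z + C%:Z)%:~R :> R by rewrite ler_int.
  rewrite intrM intrD intrN -!pmulrn => le.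
  have : 0 <= C%:R * (e.+1%:R - 1) :> R by rewrite mulr_ge0 // subr_ge0.
  by rewrite natrM in le; lra.
have le2 : - m%:~R - C'%:R <= N%:R * (Q'%:R / e'.+1%:R) :> R.
  rewrite mulrA ler_pdivlMr; last by lra.
  have : (- (N * Q' + C')%:Z)%:~R <= (m * e'.+1%:Z)%:~R :> R by rewrite ler_int.
  rewrite intrM intrN -!pmulrn => le.
  have : 0 <= C'%:R * (e'.+1%:R - 1) :> R by rewrite mulr_ge0 // subr_ge0.
  by rewrite natrD natrM in le; lra.
have : 0 <= N%:R * (T - Q'%:R / e'.+1%:R) by rewrite mulr_ge0 // subr_ge0.
move: (Q%:R / _) (Q'%:R / _) le1 le2 => x x' le1 le2.
lra.
Qed.

(** Let S be the set of basis indices of slope greater than sigma in the first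
    fibre, so that its excess is the sum over S minus #|S| sigma. Any injective
    choice of #|S| slopes in the second fibre sums to at most #|S| sigma plus the
    excess there. *)
Lemma excess_le (sigma : R) : 0 <= sigma ->
  excess (fun j => (q j)%:R / e.+1%:R) d sigma <=
  excess (fun j => (q' j)%:R / e'.+1%:R) d' sigma.
Proof.
move=> s0; rewrite !excessE; set E' := leRHS.
pose S := [set p | sigma < slope p]%SET.
pose f (a : 'I_#|S|) := enum_val a.
have -> : \sum_p Num.max 0 (slope p - sigma) = \sum_a slope (f a) - #|S|%:R * sigma.
  rewrite -(big_enum_val slope) /= mulr_natl -sumr_const -sumrB.
  rewrite [RHS]big_mkcond; apply: eq_bigr => p _; rewrite inE.
  case: ltP => sp; first by apply/max_idPr; rewrite subr_ge0 ltW.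
  by apply/max_idPl; rewrite subr_le0.
rewrite lerBlDr; apply: sum_slopes_le; first exact: enum_val_inj.
  move=> a; have := enum_valP a; rewrite inE lt0n; apply: contraTneq => q0.
  by rewrite -leNgt /slope q0 mul0r.
move=> f' f'I.
apply: (@le_trans _ _ (\sum_a (Num.max 0 (slope' (f' a) - sigma) + sigma))).
  by apply: ler_sum => a _; rewrite -lerBlDr le_max lexx orbT.
rewrite big_split /= sumr_const card_ord -[sigma *+ _]mulr_natl lerD2r.
rewrite /E' (bigID (mem (f' @: 'I_#|S|))) /= big_imset /=; last first.
  by move=> a1 a2 _ _; exact: f'I.
by rewrite lerDl; apply: sumr_ge0 => p _; rewrite le_max lexx.
Qed.
End Comparison.

Theorem mainTheorem6 (R : realType) (A : idomainType) (mu : nat)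
    (M : diffmod (1 : A)) :
  noetherian A ->
  integrally_closed A ->
  has_rank M mu ->
  (forall (Q : prime_idealr A) (p : nat),
     p \in [pchar residue_field Q] -> (mu < p)%N) ->
  forall (P : prime_idealr A)
    (MP : diffmod (1 : residue_field P)) (iP : M -> MP)
    (MK : diffmod (1 : {fraction A})) (iK : M -> MK),
  is_specialization iP ->
  is_generic_fibre iK ->
  forall NPP NP : set (R * R),
  newton_polygon MP NPP -> newton_polygon MK NP ->
  NPP `<=` NP.
Proof.
move=> _ _ _ _ P MP iP MK iK bcP bcK NPP NP npP npK.
have [n [g [s gs]]] := projective_frame (diffmod_projective M).
have [mu1 [e1 [r1 [q1 [d1 [growth1 ->]]]]]] := newton_polygon_growth gs bcP npP.
have [mu2 [e2 [r2 [q2 [d2 [growth2 ->]]]]]] := newton_polygon_growth gs bcK npK.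
have uu' (a : A) : to_residue P a != 0 -> FracField.tofrac a != 0.
  by rewrite tofrac_eq0; apply: contraNneq => ->; rewrite rmorph0.
apply: polygon_sub.
- by move=> j; rewrite divr_ge0.
- by move=> j; rewrite divr_ge0.
- exact: (fibre_dim_le _ growth1 growth2).
- exact: (fibre_rank_le _ growth1 growth2).
- exact: (excess_le _ growth1 growth2).
Qed.
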